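(* Let $a,b$ be real numbers with $0<a<b$, let $n\ge2$ be a real number and let $q\ge1$. Then $$\left|L_{n}^{n}(a,b)+\frac{(n-1)\,G^{2}(a,b)\,L_{n-2}^{n-2}(a,b)}{2}-\frac12A^{n}(a,b)\right|$$ $$\le\frac{A(a,b)^{1-\frac1q}}{4\cdot 12^{1/q}}\left\{\bigl[(nb^{n-1})^{q}(2a+b)+(na^{n-1})^{q}(4a+5b)\bigr]^{1/q}+\bigl[(na^{n-1})^{q}(a+2b)+(nb^{n-1})^{q}(5a+4b)\bigr]^{1/q}\right\}.$$
   Context: For $0<a<b$: $A(a,b)=\frac{a+b}{2}$ (arithmetic mean) and $G(a,b)=\sqrt{ab}$ (geometric mean). The generalized logarithmic mean is $L_{p}(a,b)=\left(\frac{b^{p+1}-a^{p+1}}{(p+1)(b-a)}\right)^{1/p}$ for real $p\ne -1,0$, so that $L_{p}^{p}(a,b)=\frac{b^{p+1}-a^{p+1}}{(p+1)(b-a)}$; for $p=0$ the symbol $L_{0}^{0}(a,b)$ is read by this last formula as $1$. Superscripts on $A,G,L_p$ denote powers. *)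

(* Defs.v *)
From Stdlib Require Import Reals Lra.
Open Scope R_scope.

Definition Amean (a b : R) : R := (a + b) / 2.

Definition Gmean (a b : R) : R := sqrt (a * b).

(* Meaningful for 0 < a < b and p <> -1; the base of the outer power is then
   positive, so that [Rpower] is the usual real power.  At p = 0 the exponent
   [1 / 0] is an unspecified real, but the base is 1, and the zeroth power of
   this mean is 1 in any case: see [Rpower_Lmean_0]. *)
Definition Lmean (p a b : R) : R :=
  Rpower ((Rpower b (p + 1) - Rpower a (p + 1)) / ((p + 1) * (b - a))) (1 / p).

Lemma Rpower_Lmean (p a b : R) : 0 < a -> a < b -> p + 1 > 0 -> p <> 0 ->
  Rpower (Lmean p a b) p =
  (Rpower b (p + 1) - Rpower a (p + 1)) / ((p + 1) * (b - a)).
Proof.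
intros Ha Hab Hp Hp0; unfold Lmean.
rewrite Rpower_mult; replace (1 / p * p) with 1 by now field.
apply Rpower_1, Rdiv_lt_0_compat.
- assert (H : Rpower a (p + 1) < Rpower b (p + 1)).
  { apply Rlt_Rpower_l; lra. }
  lra.
- apply Rmult_lt_0_compat; lra.
Qed.

Lemma Rpower_Lmean_0 (a b : R) : 0 < a -> a < b ->
  Rpower (Lmean 0 a b) 0 = 1 /\
  (Rpower b (0 + 1) - Rpower a (0 + 1)) / ((0 + 1) * (b - a)) = 1.
Proof.
intros Ha Hab; split.
- unfold Rpower; rewrite Rmult_0_l; exact exp_0.
- rewrite Rplus_0_l, !Rpower_1 by lra; field; lra.
Qed.

(* Main.v *)
Require Import Defs.
From Stdlib Require Import Reals Lra.
From Coquelicot Require Import Coquelicot.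
Open Scope R_scope.

(** Put [f x = x ^ n], [A = (a + b) / 2].  Integration by parts on the two halves of
    [[a, b]] shows that the quantity inside the absolute value is
    [1 / (b - a)] times the sum of the integrals of [(a + b / 2 - x) * f' x] over
    [[a, A]] and of [(b + a / 2 - x) * f' x] over [[A, b]].  Both kernels are
    positive of mass [(b - a) * A / 4], and the bound is the power mean inequality
    followed by the convexity of [f' ^ q].  Integrals of powers are avoided:
    convexity and the tangent line of [y ^ q] at the final power mean [M] bound
    [f'] by one affine function [l], for which the integral of kernel times [l] is
    exactly [M] times the mass, and the bounds are integrated by comparing
    explicit antiderivatives. *)

Lemma Rpower_pos (x y : R) : 0 < Rpower x y.
Proof. apply exp_pos. Qed.

Lemma ln_ge_1_minus_inv (t : R) : 0 < t -> 1 - / t <= ln t.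
Proof.
intros Ht; pose proof (exp_ineq1_le (- ln t)) as H.
rewrite exp_Ropp, exp_ln in H by assumption; lra.
Qed.

Lemma Rpower_bernoulli (t r : R) : 0 < t -> 1 <= r -> 1 + r * (t - 1) <= Rpower t r.
Proof.
intros Ht Hr.
(* [t ^ (r - 1) >= 1 + (r - 1) * ln t >= 1 + (r - 1) * (1 - 1 / t)] *)
replace r with (1 + (r - 1)) at 2 by ring.
rewrite Rpower_plus, Rpower_1 by assumption.
replace (1 + r * (t - 1)) with (t * (1 + (r - 1) * (1 - / t))) by (field; lra).
apply Rmult_le_compat_l; [lra|].
apply Rle_trans with (1 + (r - 1) * ln t).
- apply Rplus_le_compat_l, Rmult_le_compat_l; [lra | now apply ln_ge_1_minus_inv].
- apply exp_ineq1_le.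
Qed.

(** Bernoulli's inequality at [x / y], scaled by [y ^ r]. *)
Lemma Rpower_tangent (x y r : R) : 0 < x -> 0 < y -> 1 <= r ->
  Rpower y r * (1 + r * (x / y - 1)) <= Rpower x r.
Proof.
intros Hx Hy Hr.
replace x with (y * (x / y)) at 2 by (field; lra).
rewrite <- Rpower_mult_distr by (try apply Rdiv_lt_0_compat; assumption).
apply Rmult_le_compat_l; [apply Rlt_le, Rpower_pos|].
apply Rpower_bernoulli; [now apply Rdiv_lt_0_compat | assumption].
Qed.

(** The tangent at [x] is evaluated at [a] and [b] with weights [b - x] and [x - a]; the slope terms
    cancel in the sum. *)
Lemma Rpower_below_chord (a b x r : R) : 0 < a -> a < b -> a <= x <= b -> 1 <= r ->
  Rpower x r <= (Rpower a r * (b - x) + Rpower b r * (x - a)) / (b - a).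
Proof.
intros Ha Hab Hx Hr.
pose proof (Rpower_tangent a x r ltac:(lra) ltac:(lra) Hr) as H1.
pose proof (Rpower_tangent b x r ltac:(lra) ltac:(lra) Hr) as H2.
apply Rmult_le_compat_r with (r := b - x) in H1; [|lra].
apply Rmult_le_compat_r with (r := x - a) in H2; [|lra].
apply Rmult_le_reg_r with (b - a); [lra|].
unfold Rdiv at 1; rewrite (Rmult_assoc _ (/ (b - a))), Rinv_l, Rmult_1_r by lra.
apply Rle_trans with (2 := Rplus_le_compat _ _ _ _ H1 H2).
right; field; lra.
Qed.

(** Stands in for monotonicity of the integral, through the mean value theorem for [g - f]. *)
Lemma increment_le (f g f' g' : R -> R) (u v : R) : u < v ->
  (forall x, u <= x <= v -> is_derive f x (f' x)) ->
  (forall x, u <= x <= v -> is_derive g x (g' x)) ->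
  (forall x, u <= x <= v -> f' x <= g' x) ->
  f v - f u <= g v - g u.
Proof.
intros Huv Hf Hg Hle.
destruct (MVT_cor2 (fun x => g x - f x) (fun x => g' x - f' x) u v Huv)
  as [x [Hx Hxuv]].
- intros x Hx; apply is_derive_Reals.
  apply (is_derive_minus (K := R_AbsRing) (V := R_NormedModule)); auto.
- assert (Hd : 0 <= (g' x - f' x) * (v - u)).
  { apply Rmult_le_pos; [specialize (Hle x) |]; lra. }
  lra.
Qed.

Lemma is_derive_kernel_power (c n x : R) : 0 < x -> n + 1 <> 0 ->
  is_derive (fun x => (c - x) * Rpower x n + Rpower x (n + 1) / (n + 1)) x
            ((c - x) * (n * Rpower x (n - 1))).
Proof.
intros Hx Hn.
unfold Rpower; auto_derive; [now repeat split|].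
replace ((n + 1) * ln x) with (n * ln x + ln x) by ring.
replace (exp ((n - 1) * ln x)) with (exp (n * ln x) / x).
- rewrite exp_plus, exp_ln by assumption; field; lra.
- replace ((n - 1) * ln x) with (n * ln x + - ln x) by ring.
  rewrite exp_plus, exp_Ropp, exp_ln by assumption; reflexivity.
Qed.

Lemma is_derive_kernel_affine (c al be x : R) :
  is_derive (fun x => c * al * x + (c * be - al) * x ^ 2 / 2 - be * x ^ 3 / 3) x
            ((c - x) * (al + be * x)).
Proof. auto_derive; [exact I | field]. Qed.

(** The integral of [(c - x) * (n * x ^ (n - 1))] over [[u, v]], given by the antiderivative that
    integration by parts yields. *)
Definition kernel_integral (c n u v : R) : R :=
  ((c - v) * Rpower v n + Rpower v (n + 1) / (n + 1))
  - ((c - u) * Rpower u n + Rpower u (n + 1) / (n + 1)).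

Lemma kernel_integral_nonneg (c n u v : R) : 0 < u -> u < v -> v <= c -> 0 <= n ->
  0 <= kernel_integral c n u v.
Proof.
intros Hu Huv Hvc Hn.
replace 0 with (0 - 0) by ring.
apply (increment_le (fun _ => 0)
         (fun x => (c - x) * Rpower x n + Rpower x (n + 1) / (n + 1))
         (fun _ => 0) (fun x => (c - x) * (n * Rpower x (n - 1))) u v Huv).
- intros x _; apply (is_derive_const (K := R_AbsRing) (V := R_NormedModule)).
- intros x Hx; apply is_derive_kernel_power; lra.
- intros x Hx; apply Rmult_le_pos; [lra|].
  apply Rmult_le_pos; [lra | apply Rlt_le, Rpower_pos].
Qed.

Lemma kernel_integral_le (c n u v al be : R) : 0 < u -> u < v -> v <= c -> 0 <= n ->
  (forall x, u <= x <= v -> n * Rpower x (n - 1) <= al + be * x) ->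
  kernel_integral c n u v <=
  (c * al * v + (c * be - al) * v ^ 2 / 2 - be * v ^ 3 / 3)
  - (c * al * u + (c * be - al) * u ^ 2 / 2 - be * u ^ 3 / 3).
Proof.
intros Hu Huv Hvc Hn Hle.
apply (increment_le
         (fun x => (c - x) * Rpower x n + Rpower x (n + 1) / (n + 1))
         (fun x => c * al * x + (c * be - al) * x ^ 2 / 2 - be * x ^ 3 / 3)
         (fun x => (c - x) * (n * Rpower x (n - 1)))
         (fun x => (c - x) * (al + be * x)) u v Huv).
- intros x Hx; apply is_derive_kernel_power; lra.
- intros x _; apply is_derive_kernel_affine.
- intros x Hx; apply Rmult_le_compat_l; [lra | now apply Hle].
Qed.

Lemma power_derivative_le_affine (a b n q M x : R) :
  0 < a -> a < b -> 2 <= n -> 1 <= q -> 0 < M -> a <= x <= b ->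
  n * Rpower x (n - 1) <=
  M + M / q * ((Rpower (n * Rpower a (n - 1)) q * (b - x)
                + Rpower (n * Rpower b (n - 1)) q * (x - a))
               / ((b - a) * Rpower M q) - 1).
Proof.
intros Ha Hab Hn Hq HM Hx.
set (y := n * Rpower x (n - 1)).
assert (Hy : 0 < y) by (apply Rmult_lt_0_compat; [lra | apply Rpower_pos]).
assert (HMq := Rpower_pos M q).
(* This exponent makes [f' ^ q] convex, so that it lies below its chord. *)
assert (Hr : 1 <= (n - 1) * q).
{ apply Rle_trans with (1 * 1); [lra | apply Rmult_le_compat; lra]. }
assert (Hchord : Rpower y q <= (Rpower (n * Rpower a (n - 1)) q * (b - x)
           + Rpower (n * Rpower b (n - 1)) q * (x - a)) / (b - a)).
{ unfold y; rewrite <- !Rpower_mult_distr by (try apply Rpower_pos; lra).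
  rewrite !Rpower_mult.
  replace ((Rpower n q * Rpower a ((n - 1) * q) * (b - x)
            + Rpower n q * Rpower b ((n - 1) * q) * (x - a)) / (b - a))
    with (Rpower n q * ((Rpower a ((n - 1) * q) * (b - x)
            + Rpower b ((n - 1) * q) * (x - a)) / (b - a))) by (field; lra).
  apply Rmult_le_compat_l; [apply Rlt_le, Rpower_pos|].
  now apply Rpower_below_chord. }
assert (Htan := Rle_trans _ _ _ (Rpower_tangent y M q Hy HM Hq) Hchord).
(* The reciprocal slope of the tangent at [M]: multiplying by it solves the inequality for [y]. *)
apply Rmult_le_compat_l with (r := M / (q * Rpower M q)) in Htan;
  [| apply Rlt_le, Rdiv_lt_0_compat; [| apply Rmult_lt_0_compat]; lra].
replace (M / (q * Rpower M q) * (Rpower M q * (1 + q * (y / M - 1))))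
  with (y - (M - M / q)) in Htan by (field; lra).
match type of Htan with _ <= ?r => apply Rle_trans with (M - M / q + r) end; [lra|].
right; field; lra.
Qed.

Lemma Rpower_inv_exponent (x q : R) : 0 < x -> q <> 0 -> Rpower (Rpower x (1 / q)) q = x.
Proof.
intros Hx Hq; rewrite Rpower_mult.
replace (1 / q * q) with 1 by now field.
now apply Rpower_1.
Qed.

(* The last hypothesis says that the kernel has the same integral against
   the chord [x |-> (Ya * (b - x) + Yb * (x - a)) / (b - a)] as against the constant
   [M ^ q]. *)
Lemma kernel_integral_le_power_mean (a b n q c u v M : R) :
  0 < a -> a < b -> 2 <= n -> 1 <= q -> 0 < M ->
  a <= u -> u < v -> v <= b -> v <= c ->
  let Ya := Rpower (n * Rpower a (n - 1)) q in
  let Yb := Rpower (n * Rpower b (n - 1)) q in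
  let prim al be x := c * al * x + (c * be - al) * x ^ 2 / 2 - be * x ^ 3 / 3 in
  prim (Ya * b - Yb * a) (Yb - Ya) v - prim (Ya * b - Yb * a) (Yb - Ya) u
    = (b - a) * Rpower M q * (prim 1 0 v - prim 1 0 u) ->
  kernel_integral c n u v <= M * (prim 1 0 v - prim 1 0 u).
Proof.
intros Ha Hab Hn Hq HM Hau Huv Hvb Hvc Ya Yb prim Hmean.
assert (HMq := Rpower_pos M q).
(* Chosen so that [k * (b - a) * M ^ q = M / q], which cancels the term [- M / q] after
   integration. *)
set (k := M / (q * ((b - a) * Rpower M q))).
eapply Rle_trans.
- apply kernel_integral_le with
    (al := M - M / q + k * (Ya * b - Yb * a)) (be := k * (Yb - Ya)); try lra.
  intros x Hx.
  eapply Rle_trans; [apply (power_derivative_le_affine a b n q M); lra|].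
  fold Ya Yb; unfold k; right; field; lra.
- apply Req_le.
  (* [prim] is linear in [(al, be)], and the increment of [prim 1 0] is the mass of the kernel. *)
  transitivity ((M - M / q) * (prim 1 0 v - prim 1 0 u)
    + k * (prim (Ya * b - Yb * a) (Yb - Ya) v - prim (Ya * b - Yb * a) (Yb - Ya) u)).
  + unfold prim; field; lra.
  + rewrite Hmean; unfold k; field; lra.
Qed.

(** Includes [p = 0], which occurs as [n - 2] when [n = 2]. *)
Lemma Rpower_Lmean_ge0 (p a b : R) : 0 < a -> a < b -> 0 <= p ->
  Rpower (Lmean p a b) p =
  (Rpower b (p + 1) - Rpower a (p + 1)) / ((p + 1) * (b - a)).
Proof.
intros Ha Hab Hp.
destruct (Req_dec p 0) as [-> | Hp0].
- destruct (Rpower_Lmean_0 a b Ha Hab) as [-> ->]; reflexivity.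
- apply Rpower_Lmean; lra.
Qed.

(** The kernels equal [a / 2] and [b / 2] at the midpoint, which gives [- (b - a) / 2 * A ^ n]. The
    outer boundary terms [a / 2 * b ^ n - b / 2 * a ^ n] have the common factor [a * b = G ^ 2]. *)
Lemma Lmean_combination_kernel_integral (a b n : R) : 0 < a -> a < b -> 2 <= n ->
  Rpower (Lmean n a b) n
    + (n - 1) * (Gmean a b) ^ 2 * Rpower (Lmean (n - 2) a b) (n - 2) / 2
    - 1 / 2 * Rpower (Amean a b) n
  = (kernel_integral (a + b / 2) n a (Amean a b)
     + kernel_integral (b + a / 2) n (Amean a b) b) / (b - a).
Proof.
intros Ha Hab Hn.
rewrite !Rpower_Lmean_ge0 by lra.
unfold Gmean; rewrite pow2_sqrt by (apply Rmult_le_pos; lra).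
replace (n - 2 + 1) with (n - 1) by ring.
assert (Hpow : forall x, 0 < x -> Rpower x n = x * Rpower x (n - 1)).
{ intros x Hx; rewrite <- (Rpower_1 x Hx) at 2; rewrite <- Rpower_plus.
  f_equal; ring. }
unfold kernel_integral.
rewrite (Hpow a Ha), (Hpow b) by lra.
unfold Amean; field; lra.
Qed.

(** With [x = A], turns mass times power mean into the form of the stated bound. *)
Lemma Rmult_power_mean (x P q : R) : 0 < x -> 0 < P ->
  x * Rpower (P / (12 * x)) (1 / q)
  = Rpower x (1 - 1 / q) / Rpower 12 (1 / q) * Rpower P (1 / q).
Proof.
intros Hx HP.
unfold Rminus, Rdiv at 1; rewrite Rpower_plus, Rpower_1, Rpower_Ropp by assumption.
rewrite <- Rpower_mult_distr by (try apply Rinv_0_lt_compat; lra).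
replace (Rpower (/ (12 * x)) (1 / q)) with (/ (Rpower 12 (1 / q) * Rpower x (1 / q))).
- field; split; apply Rgt_not_eq, Rpower_pos.
- rewrite Rpower_mult_distr by lra.
  unfold Rpower; rewrite ln_Rinv, <- exp_Ropp by lra; f_equal; ring.
Qed.

Theorem proposition8 (a b n q : R)
  (Ha : 0 < a) (Hab : a < b) (Hn : 2 <= n) (Hq : 1 <= q) :
  Rabs (Rpower (Lmean n a b) n
        + (n - 1) * (Gmean a b) ^ 2 * Rpower (Lmean (n - 2) a b) (n - 2) / 2
        - 1 / 2 * Rpower (Amean a b) n)
  <= Rpower (Amean a b) (1 - 1 / q) / (4 * Rpower 12 (1 / q))
     * (Rpower (Rpower (n * Rpower b (n - 1)) q * (2 * a + b)
                + Rpower (n * Rpower a (n - 1)) q * (4 * a + 5 * b)) (1 / q)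
        + Rpower (Rpower (n * Rpower a (n - 1)) q * (a + 2 * b)
                  + Rpower (n * Rpower b (n - 1)) q * (5 * a + 4 * b)) (1 / q)).
Proof.
assert (HA : a < Amean a b < b) by (unfold Amean; lra).
rewrite (Lmean_combination_kernel_integral a b n Ha Hab Hn).
set (Ya := Rpower (n * Rpower a (n - 1)) q).
set (Yb := Rpower (n * Rpower b (n - 1)) q).
assert (HYa : 0 < Ya) by apply Rpower_pos.
assert (HYb : 0 < Yb) by apply Rpower_pos.
set (P := Yb * (2 * a + b) + Ya * (4 * a + 5 * b)).
set (Q := Ya * (a + 2 * b) + Yb * (5 * a + 4 * b)).
assert (HP : 0 < P) by (apply Rplus_lt_0_compat; apply Rmult_lt_0_compat; lra).
assert (HQ : 0 < Q) by (apply Rplus_lt_0_compat; apply Rmult_lt_0_compat; lra).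
assert (Hmean_pos : forall S, 0 < S -> 0 < S / (12 * Amean a b)).
{ intros S HS; apply Rdiv_lt_0_compat; lra. }
rewrite Rabs_pos_eq.
(* Both kernels are nonnegative: [A <= a + b / 2] and [b <= b + a / 2]. *)
2:{ apply Rdiv_le_0_compat; [|lra].
    apply Rplus_le_le_0_compat; apply kernel_integral_nonneg; unfold Amean; lra. }
(* [P / (12 * A)] is the kernel-weighted average over [[a, A]] of the chord of [f' ^ q], and
   [(b - a) / 4 * A] is the mass; [Q] plays the same role on [[A, b]]. *)
assert (H1 : kernel_integral (a + b / 2) n a (Amean a b)
             <= (b - a) / 4 * (Amean a b * Rpower (P / (12 * Amean a b)) (1 / q))).
{ eapply Rle_trans.
  - apply (kernel_integral_le_power_mean a b n q _ _ _
             (Rpower (P / (12 * Amean a b)) (1 / q)));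
      try apply Rpower_pos; try (unfold Amean; lra).
    rewrite Rpower_inv_exponent by (try apply Hmean_pos; lra).
    fold Ya Yb; unfold P, Amean; field; lra.
  - right; unfold Amean; field. }
assert (H2 : kernel_integral (b + a / 2) n (Amean a b) b
             <= (b - a) / 4 * (Amean a b * Rpower (Q / (12 * Amean a b)) (1 / q))).
{ eapply Rle_trans.
  - apply (kernel_integral_le_power_mean a b n q _ _ _
             (Rpower (Q / (12 * Amean a b)) (1 / q)));
      try apply Rpower_pos; try (unfold Amean; lra).
    rewrite Rpower_inv_exponent by (try apply Hmean_pos; lra).
    fold Ya Yb; unfold Q, Amean; field; lra.
  - right; unfold Amean; field. }
rewrite Rmult_power_mean in H1, H2 by lra.
apply Rmult_le_reg_r with (b - a); [lra|].
unfold Rdiv at 1; rewrite Rmult_assoc, Rinv_l, Rmult_1_r by lra.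
apply Rle_trans with (1 := Rplus_le_compat _ _ _ _ H1 H2).
right; field; apply Rgt_not_eq, Rpower_pos.
Qed.
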